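(* Let $p$ be an odd prime, let $q\in\mathbb{C}_p$ with $|q-1|_p<1$, let $d$ be an odd positive integer with $(p,d)=1$, and let $\chi$ be a Dirichlet character with conductor $d$. Then $$\int_{\mathbb{Z}_p}e^{tx}\chi(x)\,d\mu_{-q}(x)=\frac{[2]_q\sum_{l=0}^{d-1}(-1)^lq^l\chi(l)e^{lt}}{q^de^{dt}+1}=\sum_{n=0}^{\infty}H_{n,\chi}(-q^{-1})\frac{t^n}{n!}.$$
   Context: $\mathbb{Z}_p$ is the ring of $p$-adic integers and $\mathbb{C}_p$ is the completion of the algebraic closure of $\mathbb{Q}_p$, with absolute value normalized by $|p|_p=1/p$. Notation: $[2]_q=1+q$, and for an integer $x\ge 0$, $[x]_{-q}=\frac{1-(-q)^x}{1+q}$. The fermionic $p$-adic $q$-integral of a function $f$ on $\mathbb{Z}_p$ is $$I_{-q}(f)=\int_{\mathbb{Z}_p} f(x)\,d\mu_{-q}(x)=\lim_{N\to\infty}\frac{1}{[p^N]_{-q}}\sum_{x=0}^{p^N-1}f(x)(-q)^x .$$ Here it is applied to $f(x)=e^{tx}\chi(x)$, with $e^{tx}$ expanded in powers of $t$ and the identity read coefficientwise in $t$. The numbers $H_{n,\chi}(-q^{-1})$, called the generalized Frobenius-Euler numbers attached to $\chi$, are the coefficients in the expansion $\frac{[2]_q\sum_{l=0}^{d-1}(-1)^lq^l\chi(l)e^{lt}}{q^de^{dt}+1}=\sum_{n\ge0}H_{n,\chi}(-q^{-1})\frac{t^n}{n!}$.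
   Formalization: The integral of e^{tx}χ(x) is taken as the limit of sums over 0≤x<dp^N divided by [dp^N]_{-q}, instead of p^N; for d>1 the identity fails along p^N (e.g. p=5, d=3, q=1, constant coefficient: no limit). For d=1 nothing changes. *)

(* Defs.v *)
From HB Require Import structures.
From mathcomp Require Import all_boot all_order all_algebra.
From mathcomp Require Import all_classical all_reals all_analysis.
From mathcomp Require Import ring.
Set Implicit Arguments.
Unset Strict Implicit.
Unset Printing Implicit Defensive.
Import Order.TTheory GRing.Theory Num.Theory.
Import numFieldNormedType.Exports.
Local Open Scope classical_set_scope.
Local Open Scope ring_scope.

Section Cp.
Variables (R : realType) (p : nat) (K : fieldType) (abs : K -> R).

Definition abs_cvg (u : nat -> K) (l : K) : Prop :=
  (fun N => abs (u N - l)) @ \oo --> (0 : R).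

Definition abs_cauchy (u : nat -> K) : Prop :=
  forall e : R, 0 < e -> exists N0 : nat, forall m n : nat,
    (N0 <= m)%N -> (N0 <= n)%N -> abs (u m - u n) < e.

Record padic_absolute_value : Prop := PadicAbsoluteValue {
  pabs_ge0 : forall x, 0 <= abs x;
  pabs_eq0 : forall x, abs x = 0 <-> x = 0;
  pabsM : forall x y, abs (x * y) = abs x * abs y;
  pabsD : forall x y, abs (x + y) <= Num.max (abs x) (abs y);
  pabs_p : abs p%:R = p%:R^-1 }.

(* Q_p inside K: the closure of the prime field Q.  When K is complete and
   abs is normalized as above, this is the completion of Q for |.|_p. *)
Definition Qp_in : set K :=
  [set x | exists u : nat -> rat, abs_cvg (fun N => ratr (u N)) x].

Definition Qpbar_in : set K :=
  [set x | exists P : {poly K},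
     [/\ P != 0, forall i, Qp_in P`_i & root P x]].

(* K is the completion of an algebraic closure of Q_p.  This determines
   (K, abs) up to isometric isomorphism. *)
Record is_Cp : Prop := IsCp {
  Cp_abs : padic_absolute_value;
  Cp_complete : forall u, abs_cauchy u -> exists l, abs_cvg u l;
  Cp_Qpbar_closed : forall P : {poly K}, (1 < size P)%N ->
    (forall i, Qpbar_in P`_i) -> exists2 x, Qpbar_in x & root P x;
  Cp_Qpbar_dense : forall (x : K) (e : R), 0 < e ->
    exists2 y, Qpbar_in y & abs (x - y) < e }.

End Cp.

Section DirichletCharacter.
Variables (K : fieldType) (d : nat) (chi : int -> K).

Record dirichlet_character : Prop := DirichletCharacter {
  dchar1 : chi 1 = 1;
  dcharM : forall x y, chi (x * y) = chi x * chi y;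
  dchar_per : forall x, chi (x + d%:Z) = chi x;
  dchar_eq0 : forall x, chi x != 0 <-> coprimez x d%:Z }.

Definition induced_from (m : nat) : Prop :=
  forall x y : int, coprimez x d%:Z -> coprimez y d%:Z ->
    (x = y %[mod m%:Z])%Z -> chi x = chi y.

(* A character mod d of conductor d, i.e. a primitive character mod d. *)
Definition dirichlet_character_of_conductor : Prop :=
  dirichlet_character /\
  (forall m : nat, (m %| d)%N -> induced_from m -> m = d).

End DirichletCharacter.

(* Formal power series in t are represented by their coefficient sequences;
   coefficients of t^n, not of t^n / n!. *)
Section PowerSeries.
Variable K : fieldType.
Implicit Types a b : nat -> K.

(* e^{xt} *)
Definition ps_exp (x : K) : nat -> K := fun n => x ^+ n / n`!%:R.

Definition ps_mul a b : nat -> K :=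
  fun n => \sum_(k < n.+1) a k * b (n - k)%N.

Fixpoint ps_div_seq a b (n : nat) : seq K :=
  if n is n'.+1 then
    let s := ps_div_seq a b n' in
    rcons s ((a n' - \sum_(k < n') s`_k * b (n' - k)%N) / b 0%N)
  else [::].

(* The quotient a / b, for b 0 != 0; see ps_divK. *)
Definition ps_div a b : nat -> K := fun n => (ps_div_seq a b n.+1)`_n.

Lemma size_ps_div_seq a b n : size (ps_div_seq a b n) = n.
Proof. by elim: n => //= n IHn; rewrite size_rcons IHn. Qed.

Lemma nth_ps_div_seq a b n k : (k < n)%N -> (ps_div_seq a b n)`_k = ps_div a b k.
Proof.
elim: n => // n IHn; rewrite ltnS leq_eqVlt => /orP[/eqP -> //|ltkn].
by rewrite /= nth_rcons size_ps_div_seq ltkn IHn.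
Qed.

Lemma ps_divK a b : b 0%N != 0 -> ps_mul (ps_div a b) b =1 a.
Proof.
move=> b0 n; rewrite /ps_mul big_ord_recr /= subnn {2}/ps_div /=.
rewrite nth_rcons size_ps_div_seq ltnn eqxx divfK //.
under eq_bigr => k _ do rewrite -(nth_ps_div_seq a b (ltn_ord k)).
by rewrite addrC subrK.
Qed.

End PowerSeries.

Section FermionicIntegral.
Variables (R : realType) (p : nat) (K : fieldType) (abs : K -> R) (q : K).

(* [x]_{-q} *)
Definition qnum_neg (x : nat) : K := (1 - (- q) ^+ x) / (1 + q).

(* The fermionic p-adic q-integral of f exists and equals I.
   For d = 1 this is the integral over Z_p.  In general f is a function on
   X = lim_N Z/dp^N Z, which surjects onto Z_p; only its values on the natural
   numbers enter the limit.  A character mod d is a continuous function on X,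
   but does not factor through Z_p when d > 1, and for it the limit taken
   along p^N instead of dp^N does not exist in general.  For continuous
   functions on Z_p the two limits coincide: see is_fermionic_integral_Zp. *)
Definition is_fermionic_integral (d : nat) (f : nat -> K) (I : K) : Prop :=
  abs_cvg abs (fun N => (qnum_neg (d * p ^ N))^-1 *
                        \sum_(0 <= x < d * p ^ N) f x * (- q) ^+ x) I.

(* Coefficientwise integral of F(x) = sum_n F x n t^n. *)
Definition is_ps_fermionic_integral (d : nat) (F : nat -> nat -> K)
    (G : nat -> K) : Prop :=
  forall n, is_fermionic_integral d (fun x => F x n) (G n).

End FermionicIntegral.

Section LevelIndependence.
Variables (R : realType) (p : nat) (K : fieldType) (abs : K -> R) (q : K).
Hypotheses (p_prime : prime p) (p_odd : odd p).
Hypotheses (absP : padic_absolute_value p abs) (q_near1 : abs (q - 1) < 1).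

Let absM := pabsM absP.
Let abs_ge0 := pabs_ge0 absP.

Lemma pabs0 : abs 0 = 0. Proof. exact/(pabs_eq0 absP). Qed.

Lemma pabs1 : abs 1 = 1.
Proof.
have n0 : abs 1 != 0.
  by apply/eqP => /(pabs_eq0 absP) /eqP; rewrite oner_eq0.
by apply: (mulfI n0); rewrite -absM !mulr1.
Qed.

Lemma pabsN x : abs (- x) = abs x.
Proof.
suff N1 : abs (-1) = 1 by rewrite -mulN1r absM N1 mul1r.
have /eqP : abs (-1) ^+ 2 = 1 by rewrite expr2 -absM mulrNN mulr1 pabs1.
rewrite sqrf_eq1 => /orP[/eqP //|/eqP h].
by have := abs_ge0 (-1); rewrite h oppr_ge0 ler10.
Qed.

Lemma pabsX x n : abs (x ^+ n) = abs x ^+ n.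
Proof. by elim: n => [|n IHn]; rewrite ?expr0 ?pabs1 // !exprS absM IHn. Qed.

Lemma pabsV x : x != 0 -> abs x^-1 = (abs x)^-1.
Proof.
move=> x0; have a0 : abs x != 0 by apply: contraNneq x0 => /(pabs_eq0 absP) ->.
by apply: (mulfI a0); rewrite -absM !divff // pabs1.
Qed.

Lemma pabsD_le x y e : abs x <= e -> abs y <= e -> abs (x + y) <= e.
Proof. by move=> hx hy; rewrite (le_trans (pabsD absP _ _))// ge_max hx. Qed.

Lemma pabsD_lt x y e : abs x < e -> abs y < e -> abs (x + y) < e.
Proof. by move=> hx hy; rewrite (le_lt_trans (pabsD absP _ _))// gt_max hx. Qed.

Lemma pabs_sum (I : Type) (r : seq I) (F : I -> K) e : 0 <= e ->
  (forall i, abs (F i) <= e) -> abs (\sum_(i <- r) F i) <= e.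
Proof.
move=> e0 Fe; elim/big_ind: _ => [|x y|i _]; first by rewrite pabs0.
  exact: pabsD_le.
exact: Fe.
Qed.

Lemma pabs_nat n : abs n%:R <= 1.
Proof.
elim: n => [|n IHn]; first by rewrite pabs0 ler01.
by rewrite -addn1 natrD pabsD_le// pabs1.
Qed.

Lemma pabs2_ge1 : 1 <= abs 2%:R.
Proof.
rewrite leNgt; apply/negP => lt2.
suff : abs 1 < 1 by rewrite pabs1 ltxx.
have -> : (1 : K) = p%:R + - (2%:R * (p./2)%:R).
  have -> : p%:R = 1 + 2%:R * (p./2)%:R :> K.
    by rewrite -natrM -[1]/(1%:R) -natrD mul2n -[LHS]/(p%:R) -{1}(odd_double_half p) p_odd.
  by rewrite addrK.
apply: pabsD_lt.
  by rewrite (pabs_p absP) invf_lt1 ?ltr0n ?prime_gt0// ltr1n prime_gt1.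
rewrite pabsN absM; apply: le_lt_trans lt2.
by rewrite ler_piMr// pabs_nat.
Qed.

Lemma pabsq_le1 : abs q <= 1.
Proof. by rewrite -(subrK 1 q) pabsD_le ?pabs1// ltW. Qed.

Lemma pabsqX_near1 m : abs (q ^+ m - 1) < 1.
Proof.
elim: m => [|m IHm]; first by rewrite expr0 subrr pabs0 ltr01.
have -> : q ^+ m.+1 - 1 = q * (q ^+ m - 1) + (q - 1) by rewrite exprS; ring.
apply: pabsD_lt => //; rewrite absM; apply: le_lt_trans IHm.
by rewrite ler_piMl// pabsq_le1.
Qed.

Lemma pabs_1DqX m : 1 <= abs (1 + q ^+ m).
Proof.
rewrite leNgt; apply/negP => lt1.
have := pabs2_ge1; rewrite leNgt => /negP; apply.
have -> : 2%:R = (1 + q ^+ m) + - (q ^+ m - 1) by ring.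
by apply: pabsD_lt => //; rewrite pabsN pabsqX_near1.
Qed.

Lemma oneDqX_neq0 m : 1 + q ^+ m != 0.
Proof.
by apply/eqP => h; have := pabs_1DqX m; rewrite h pabs0 ler10.
Qed.

Lemma qnum_negE m : odd m -> (qnum_neg q m)^-1 = (1 + q) / (1 + q ^+ m).
Proof. by move=> om; rewrite /qnum_neg invf_div exprNn -signr_odd om mulN1r opprK. Qed.

Let A d (f : nat -> K) N : K := (qnum_neg q (d * p ^ N))^-1 *
                \sum_(0 <= x < d * p ^ N) f x * (- q) ^+ x.

Lemma fermionic_sum_level d f N : odd d ->
  A d f N - A 1 f N = (1 + q) / (1 + q ^+ (d * p ^ N)) *
    \sum_(0 <= j < d) \sum_(0 <= x < p ^ N)
      (f (x + j * p ^ N)%N - f x) * (- q) ^+ (x + j * p ^ N).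
Proof.
move=> d_odd; rewrite /A mul1n; set M := (p ^ N)%N.
have M_odd : odd M by rewrite oddX p_odd orbT.
rewrite !qnum_negE ?oddM ?d_odd//.
have blocks k : \sum_(0 <= x < k * M) f x * (- q) ^+ x =
    \sum_(0 <= j < k) \sum_(0 <= x < M) f (x + j * M)%N * (- q) ^+ (x + j * M).
  elim: k => [|k IHk]; first by rewrite mul0n !big_geq.
  rewrite big_nat_recr//= -IHk mulSn addnC (@big_cat_nat _ _ _ (k * M))%N //=; last exact: leq_addr.
  congr (_ + _); rewrite -{1}[(k * M)%N]add0n big_addn addnC addnK.
  by [].
have geom k : odd k -> 1 + q ^+ (k * M) = (1 + q ^+ M) * \sum_(0 <= j < k) (- q) ^+ (j * M).
  move=> ok.
  have QE : (- q) ^+ M = - q ^+ M by rewrite exprNn -signr_odd M_odd expr1 mulN1r.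
  have QkE : ((- q) ^+ M) ^+ k = - q ^+ (k * M).
    by rewrite QE exprNn -signr_odd ok expr1 mulN1r -exprM mulnC.
  have -> : 1 + q ^+ (k * M) = - (((- q) ^+ M) ^+ k - 1) by rewrite QkE; ring.
  rewrite subrX1 big_mkord -mulNr {1}QE opprB opprK; congr (_ * _).
  by apply: eq_bigr => i _; rewrite -exprM mulnC.
rewrite blocks.
have M0 := oneDqX_neq0 M; have dM0 := oneDqX_neq0 (d * M).
have -> : (1 + q) / (1 + q ^+ M) = (1 + q) / (1 + q ^+ (d * M)) * \sum_(0 <= j < d) (- q) ^+ (j * M).
  have g := geom _ d_odd.
  have s0 : \sum_(0 <= j < d) (- q) ^+ (j * M) != 0.
    by apply: contraNneq dM0 => s0; rewrite g s0 mulr0.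
  by rewrite g; field; rewrite M0 s0.
rewrite -[X in _ - X]mulrA -mulrBr mulr_suml -sumrB; congr (_ * _); apply: eq_bigr => j _.
rewrite mulr_sumr -sumrB; apply: eq_bigr => x _.
by rewrite exprD; ring.
Qed.

Lemma is_fermionic_integral_Zp d f I : odd d ->
  (forall e : R, 0 < e -> exists k : nat, forall x y : nat,
     x = y %[mod p ^ k] -> abs (f x - f y) < e) ->
  is_fermionic_integral p abs q d f I <-> is_fermionic_integral p abs q 1 f I.
Proof.
move=> d_odd f_cont.
have small e : 0 < e -> exists N0 : nat, forall N, (N0 <= N)%N -> abs (A d f N - A 1 f N) <= e.
  move=> e0; have [k fk] := f_cont e e0; exists k => N kN.
  rewrite fermionic_sum_level// absM.
  have le1 : abs ((1 + q) / (1 + q ^+ (d * p ^ N))) <= 1.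
    rewrite absM pabsV ?oneDqX_neq0//.
    rewrite mulr_ile1 ?invr_ge0//.
      by rewrite pabsD_le ?pabs1// pabsq_le1.
    by rewrite invf_le1 ?(lt_le_trans ltr01)// pabs_1DqX.
  rewrite -[leRHS]mul1r ler_pM//.
  apply: pabs_sum; first exact: ltW.
  move=> j; apply: pabs_sum; first exact: ltW.
  move=> x; rewrite absM pabsX pabsN -[leRHS]mulr1 ler_pM ?exprn_ge0//.
    apply/ltW/fk; apply/eqP; rewrite eqn_mod_dvd ?leq_addr// addKn.
    exact/dvdn_mull/dvdn_exp2l.
  by rewrite exprn_ile1// pabsq_le1.
have tr (u v : nat -> K) : (forall e, 0 < e -> exists N0 : nat,
     forall N, (N0 <= N)%N -> abs (u N - v N) <= e) -> abs_cvg abs u I -> abs_cvg abs v I.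
  move=> uv /cvgrPdist_lt uI; apply/cvgrPdist_le => e e0.
  have [N0 hN0] := uv e e0; have := uI e e0.
  move=> [N1 _ hN1]; exists (maxn N0 N1) => //= N /=.
  rewrite geq_max => /andP[N0N N1N].
  rewrite sub0r normrN ger0_norm//.
  have -> : v N - I = - (u N - v N) + (u N - I) by ring.
  apply: pabsD_le; first by rewrite pabsN hN0.
  by have := hN1 N N1N; rewrite /= sub0r normrN ger0_norm// => /ltW.
split; apply: tr => // e /small [N0 hN0]; exists N0 => N /hN0 //.
by rewrite -opprB pabsN.
Qed.

End LevelIndependence.

Section FrobeniusEuler.
Variables (K : fieldType) (d : nat) (chi : int -> K) (q : K).

(* [2]_q sum_(l < d) (-1)^l q^l chi(l) e^{lt} / (q^d e^{dt} + 1) *)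
Definition frobenius_euler_series : nat -> K :=
  ps_div
    (fun n => (1 + q) * \sum_(0 <= l < d)
                (-1) ^+ l * q ^+ l * chi l%:Z * ps_exp l%:R n)
    (fun n => q ^+ d * ps_exp d%:R n + (n == 0%N)%:R).

(* H_{n,chi}(-q^{-1}) *)
Definition frobenius_euler (n : nat) : K := n`!%:R * frobenius_euler_series n.

End FrobeniusEuler.

(* Main.v *)
Require Import Defs.
From HB Require Import structures.
From mathcomp Require Import all_boot all_order all_algebra.
From mathcomp Require Import all_classical all_reals all_analysis.
From mathcomp Require Import ring.
Set Implicit Arguments.
Unset Strict Implicit.
Unset Printing Implicit Defensive.
Import Order.TTheory GRing.Theory Num.Theory.
Import numFieldNormedType.Exports.
Local Open Scope classical_set_scope.
Local Open Scope ring_scope.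

(** Put [M = d p^N], [g x = chi(x) (-q)^x x^n / n!], and let [S] be the series
    of sums over [x < M] of [chi(x) (-q)^x e^{xt}].  Since [chi] has period [d]
    and [d], [M] are odd, shifting [x] by [d] multiplies [(-q)^x] by [- q^d], so
    [S (1 + q^d e^{dt})] has [n]-th coefficient [\sum_(x < M) (g x - g (x + d))],
    which telescopes to [\sum_(l < d) (g l - g (l + M))].  After normalization
    by [(1 + q) / (1 + q^M)] this differs from the numerator of the
    Frobenius-Euler series by a multiple of [(l + M)^n - l^n], which is divisible
    by [M] and hence [O(p^-N)].  As [1 + q^d] is a unit, this rate passes to the
    coefficients of the quotient by induction on [n]. *)

(** Cutting the sum over [[0, m + k)] at [m] or at [k] gives the same total. *)
Lemma sum_shift_telescope (V : zmodType) (g : nat -> V) (m k : nat) :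
  \sum_(0 <= x < m) g x - \sum_(0 <= x < m) g (x + k)%N =
  \sum_(0 <= x < k) g x - \sum_(0 <= x < k) g (x + m)%N.
Proof.
have split i j : \sum_(0 <= x < i + j) g x =
    \sum_(0 <= x < i) g x + \sum_(0 <= x < j) g (x + i)%N.
  rewrite (@big_cat_nat _ _ _ i)//= ?leq_addr//; congr (_ + _).
  by rewrite -{1}[i]add0n big_addn addKn.
by apply/eqP; rewrite subr_eq addrAC eq_sym subr_eq -!split addnC.
Qed.

Lemma ps_exp_add (K : fieldType) (x y : K) n :
  (forall m, (0 < m)%N -> m%:R != 0 :> K) ->
  ps_exp (x + y) n = ps_mul (ps_exp x) (ps_exp y) n.
Proof.
move=> char0; have fact_neq0 m : m`!%:R != 0 :> K by rewrite char0 ?fact_gt0.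
rewrite /ps_exp /ps_mul addrC exprDn mulr_suml; apply: eq_bigr => k _.
have kn : (k <= n)%N by rewrite -ltnS.
rewrite -(bin_fact kn) !natrM -mulr_natr.
have bin_neq0 : 'C(n, k)%:R != 0 :> K by rewrite char0 ?bin_gt0.
by field; rewrite !fact_neq0 bin_neq0.
Qed.

Section GeometricDecay.
Variables (R : realType) (p : nat) (K : fieldType) (abs : K -> R).
Hypotheses (p_prime : prime p) (absP : padic_absolute_value p abs).

(** An explicit rate [O(p^-N)], with a constant free to depend on [u], is stable under finite sums
    and scaling, so limits are taken only once, at the end. *)
Definition geometric_decay (u : nat -> K) : Prop :=
  exists C : R, forall N, abs (u N) <= C * p%:R^-1 ^+ N.

Let r_ge0 N : 0 <= (p%:R^-1 : R) ^+ N.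
Proof. by rewrite exprn_ge0 ?invr_ge0. Qed.

Lemma geometric_decayD u v : geometric_decay u -> geometric_decay v ->
  geometric_decay (fun N => u N + v N).
Proof.
move=> [C uC] [D vD]; exists (Num.max C D) => N; apply: (pabsD_le absP).
  by apply: le_trans (uC N) _; rewrite ler_wpM2r// le_max lexx.
by apply: le_trans (vD N) _; rewrite ler_wpM2r// le_max lexx orbT.
Qed.

Lemma geometric_decayZ c u : geometric_decay u ->
  geometric_decay (fun N => c * u N).
Proof.
move=> [C uC]; exists (abs c * C) => N.
by rewrite (pabsM absP) -mulrA ler_wpM2l ?(pabs_ge0 absP).
Qed.

Lemma geometric_decay_sum (I : Type) (s : seq I) (u : I -> nat -> K) :
  (forall i, geometric_decay (u i)) ->
  geometric_decay (fun N => \sum_(i <- s) u i N).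
Proof.
move=> us; elim: s => [|i s [C sC]].
  by exists 0 => N; rewrite big_nil (pabs0 absP) mul0r.
have [D hD] := geometric_decayD (us i) (ex_intro _ C sC).
by exists D => N; rewrite big_cons.
Qed.

Lemma eq_geometric_decay u v : u =1 v -> geometric_decay u -> geometric_decay v.
Proof. by move=> uv [C uC]; exists C => N; rewrite -uv. Qed.

Lemma geometric_decay_cvg u l :
  geometric_decay (fun N => u N - l) -> abs_cvg abs u l.
Proof.
move=> [C uC]; rewrite /abs_cvg.
have cvg0 : (fun N => C * p%:R^-1 ^+ N) @ \oo --> (0 : R).
  rewrite -[X in _ --> X](mulr0 C); apply: cvgMl_tmp; apply: cvg_expr.
  by rewrite ger0_norm ?invr_ge0// invf_lt1 ?ltr0n ?prime_gt0// ltr1n prime_gt1.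
apply: squeeze_cvgr cvg0; last exact: cvg_cst.
by apply: nearW => N; rewrite (pabs_ge0 absP) uC.
Qed.

(** Deconvolution: [b 0 * u N n] is the [n]-th coefficient of the product minus terms in [u N k]
    with [k < n], which decay by strong induction. *)
Lemma geometric_decay_ps_mul (u : nat -> nat -> K) (b : nat -> K) :
  b 0%N != 0 -> (forall n, geometric_decay (fun N => ps_mul (u N) b n)) ->
  forall n, geometric_decay (fun N => u N n).
Proof.
move=> b0 ub n; have [m] := ubnP n; elim: m n => // m IHm n nm.
have lower : geometric_decay
    (fun N => - \sum_(k < n) b (n - k)%N * u N k).
  apply: eq_geometric_decay (fun N => mulN1r _) _; apply: geometric_decayZ.
  apply: geometric_decay_sum => k; apply: geometric_decayZ.
  by apply: IHm; rewrite (leq_trans (ltn_ord k)).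
apply: eq_geometric_decay (geometric_decayZ (b 0%N)^-1
  (geometric_decayD (ub n) lower)) => N.
rewrite /ps_mul big_ord_recr /= subnn.
have -> : \sum_(k < n) b (n - k)%N * u N k = \sum_(k < n) u N k * b (n - k)%N.
  by apply: eq_bigr => k _; rewrite mulrC.
by rewrite addrAC subrr add0r mulrC mulfK.
Qed.

(** Characteristic zero, needed to divide by factorials. A prime [l] vanishing in [K] differs from
    [p], as [abs p%:R] is nonzero; a Bezout relation then makes 1 a multiple of [p], of absolute
    value below 1. *)
Lemma padic_natr_neq0 m : (0 < m)%N -> m%:R != 0 :> K.
Proof.
have p0 : p%:R != 0 :> K.
  apply/eqP => /(pabs_eq0 absP)/eqP; rewrite (pabs_p absP) invr_eq0 pnatr_eq0.
  by rewrite eqn0Ngt prime_gt0.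
have := @pcharf0P K => -[+ _] => natr0; move=> m0.
rewrite natr0 -?lt0n// => l; apply/negP => /andP[/= l_prime /eqP l0].
have lp : coprime l p.
  rewrite prime_coprime// dvdn_prime2//; apply: contraNneq p0 => <-.
  exact/eqP.
(* Here [u * l = v * p + 1], whose left side is zero in [K]. *)
have [u v uv _] := egcdnP p (prime_gt0 l_prime).
have : abs (1 : K) < 1.
  have -> : (1 : K) = - (v%:R * p%:R).
    have := congr1 (fun k : nat => k%:R : K) uv.
    rewrite (eqP lp) natrD !natrM l0 mulr0 => /esym/eqP.
    by rewrite addrC addr_eq0 => /eqP.
  rewrite (pabsN absP) (pabsM absP) (pabs_p absP).
  apply: (@le_lt_trans _ _ p%:R^-1).
    by rewrite ler_piMl ?invr_ge0// (pabs_nat absP).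
  by rewrite invf_lt1 ?ltr0n ?prime_gt0// ltr1n prime_gt1.
by rewrite (pabs1 absP) ltxx.
Qed.

Lemma pabs_addX_sub_le x m n : abs ((x + m)%:R ^+ n - x%:R ^+ n) <= abs m%:R.
Proof.
elim: n => [|n IHn]; first by rewrite subrr (pabs0 absP) (pabs_ge0 absP).
have -> : (x + m)%:R ^+ n.+1 - x%:R ^+ n.+1 =
    (x + m)%:R * ((x + m)%:R ^+ n - x%:R ^+ n) + m%:R * x%:R ^+ n :> K.
  by rewrite !exprS natrD; ring.
apply: (pabsD_le absP); rewrite (pabsM absP).
  by apply: le_trans IHn; rewrite ler_piMl ?(pabs_ge0 absP) ?(pabs_nat absP).
by rewrite ler_piMr ?(pabs_ge0 absP)// -natrX (pabs_nat absP).
Qed.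

Lemma pabs_natM_expn_le d N : abs (d * p ^ N)%:R <= p%:R^-1 ^+ N.
Proof.
rewrite natrM natrX (pabsM absP) (pabsX absP) (pabs_p absP).
by rewrite ler_piMl// (pabs_nat absP).
Qed.

End GeometricDecay.

Section CharacterIntegral.
Variables (R : realType) (p : nat) (K : fieldType) (abs : K -> R) (q : K).
Variables (d : nat) (chi : int -> K).
Hypotheses (p_prime : prime p) (p_odd : odd p).
Hypotheses (absP : padic_absolute_value p abs) (q_near1 : abs (q - 1) < 1).
Hypotheses (d_odd : odd d) (chi_per : forall x, chi (x + d%:Z) = chi x).

Let g n (x : nat) : K := ps_exp x%:R n * chi x%:Z * (- q) ^+ x.
Let den : nat -> K := fun n => q ^+ d * ps_exp d%:R n + (n == 0%N)%:R.

Lemma periodic_addM (x k : nat) : chi (x + d * k)%N = chi x.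
Proof.
elim: k => [|k IHk]; first by rewrite muln0 addn0.
by rewrite mulnS addnCA addnC PoszD chi_per.
Qed.

Lemma ps_mul_den (a : nat -> K) n :
  ps_mul a den n = a n + q ^+ d * ps_mul a (ps_exp d%:R) n.
Proof.
rewrite /ps_mul mulr_sumr big_ord_recr /= [in RHS]big_ord_recr /= /den subnn.
have -> : \sum_(k < n) a k * (q ^+ d * ps_exp d%:R (n - k) + ((n - k)%N == 0%N)%:R)
   = \sum_(k < n) q ^+ d * (a k * ps_exp d%:R (n - k)).
  apply: eq_bigr => k _; rewrite subn_eq0 leqNgt ltn_ord /= addr0; ring.
by rewrite eqxx /=; ring.
Qed.

(** Multiplying by [e^{dt}] turns [e^{xt}] into [e^{(x+d)t}], and [q^d (-q)^x = - (-q)^(x+d)] for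
    odd [d], hence the minus sign. *)
Lemma charsum_mul_den m n :
  ps_mul (fun k => \sum_(0 <= x < m) g k x) den n =
  \sum_(0 <= x < m) g n x - \sum_(0 <= x < m) g n (x + d)%N.
Proof.
rewrite ps_mul_den; congr (_ + _).
have -> : ps_mul (fun k => \sum_(0 <= x < m) g k x) (ps_exp d%:R) n =
    \sum_(0 <= x < m) ps_exp (x + d)%:R n * chi x * (- q) ^+ x.
  rewrite /ps_mul; under eq_bigr do rewrite mulr_suml.
  rewrite exchange_big; apply: eq_bigr => x _.
  rewrite natrD (ps_exp_add _ _ _ (padic_natr_neq0 p_prime absP)) /ps_mul.
  rewrite !mulr_suml; apply: eq_bigr => k _; rewrite /g; ring.
rewrite mulr_sumr -sumrN; apply: eq_bigr => x _.
rewrite /g PoszD chi_per exprD [(- q) ^+ d]exprNn -signr_odd d_odd expr1; ring.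
Qed.

Lemma fermionic_partial_sum_decay n :
  geometric_decay p abs (fun N =>
    ps_mul (fun k => (qnum_neg q (d * p ^ N))^-1 *
                     \sum_(0 <= x < d * p ^ N) g k x) den n -
    (1 + q) * \sum_(0 <= l < d) g n l).
Proof.
(* The [N]-dependent factor of the [l]-th error term: [1 + q^M] has absolute value at least 1 and
   [q^M] at most 1, so only the difference of powers matters. *)
have decay l : geometric_decay p abs (fun N =>
    (1 + q ^+ (d * p ^ N))^-1 * q ^+ (d * p ^ N) *
      ((l + d * p ^ N)%:R ^+ n - l%:R ^+ n)).
  exists 1 => N; rewrite !(pabsM absP) mul1r.
  apply: le_trans (pabs_natM_expn_le absP d N).
  apply: le_trans (pabs_addX_sub_le absP l _ n).
  rewrite ler_piMl ?(pabs_ge0 absP)// mulr_ile1 ?(pabs_ge0 absP)//.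
    rewrite (pabsV absP) ?(oneDqX_neq0 p_prime p_odd absP q_near1)//.
    have := pabs_1DqX p_prime p_odd absP q_near1 (d * p ^ N).
    by move=> ge1; rewrite invf_le1 ?(lt_le_trans ltr01 ge1).
  by rewrite (pabsX absP) exprn_ile1 ?(pabs_ge0 absP) ?(pabsq_le1 absP).
(* The remaining factor is independent of [N], so a large [1 / n!] only changes the constant. *)
have := geometric_decay_sum absP (index_iota 0 d) (fun l =>
  geometric_decayZ absP ((1 + q) * (chi l%:Z * (- q) ^+ l / n`!%:R)) (decay l)).
apply: eq_geometric_decay => N.
set M := (d * p ^ N)%N.
have M_odd : odd M by rewrite oddM d_odd oddX p_odd orbT.
have -> c a : ps_mul (fun k => c * a k) den n = c * ps_mul a den n.
  by rewrite /ps_mul mulr_sumr; apply: eq_bigr => k _; rewrite mulrA.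
rewrite charsum_mul_den sum_shift_telescope qnum_negE// -sumrB !mulr_sumr -sumrB.
apply: eq_bigr => l _.
have -> : g n (l + M) = - (ps_exp (l + M)%:R n * chi l * (- q) ^+ l * q ^+ M).
  rewrite /g periodic_addM exprD [(- q) ^+ M]exprNn -signr_odd M_odd expr1; ring.
have M0 := oneDqX_neq0 p_prime p_odd absP q_near1 M.
have n0 := padic_natr_neq0 p_prime absP (fact_gt0 n).
(* With [c = chi l * (- q)^l / n!], this is [c (l^n + q^M (l+M)^n) / (1 + q^M) - c l^n = c q^M
   ((l+M)^n - l^n) / (1 + q^M)], times [1 + q]. *)
by rewrite /g /ps_exp; field; rewrite M0 n0.
Qed.

Lemma fermionic_integral_periodic n :
  is_fermionic_integral p abs q d (fun x => ps_exp x%:R n * chi x%:Z)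
    (frobenius_euler_series d chi q n).
Proof.
have den0 : den 0%N = 1 + q ^+ d.
  by rewrite /den /ps_exp expr0 fact0 divr1 mulr1 addrC.
have den_neq0 : den 0%N != 0.
  by rewrite den0 (oneDqX_neq0 p_prime p_odd absP q_near1).
apply: (geometric_decay_cvg p_prime absP).
(* Deconvolution is applied to the error itself: times [den], the quotient series becomes its
   numerator. *)
pose u N k := (qnum_neg q (d * p ^ N))^-1 * \sum_(0 <= x < d * p ^ N) g k x -
              frobenius_euler_series d chi q k.
apply: (geometric_decay_ps_mul absP (u := u) den_neq0) => m.
apply: eq_geometric_decay (fermionic_partial_sum_decay m) => N.
have -> a b : ps_mul (fun k => a k - b k) den m = ps_mul a den m - ps_mul b den m.
  by rewrite /ps_mul -sumrB; apply: eq_bigr => k _; rewrite mulrBl.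
rewrite /frobenius_euler_series (ps_divK _ den_neq0); congr (_ - _ * _).
apply: eq_bigr => l _; rewrite /g -exprMn mulN1r; ring.
Qed.

End CharacterIntegral.

Theorem mainTheorem4 (R : realType) (p : nat) (Cp : fieldType) (abs : Cp -> R)
    (q : Cp) (d : nat) (chi : int -> Cp)
    (p_prime : prime p) (p_odd : odd p) (CpP : is_Cp p abs)
    (q_near1 : abs (q - 1) < 1)
    (d_gt0 : (0 < d)%N) (d_odd : odd d) (pd_coprime : coprime p d)
    (chiP : dirichlet_character_of_conductor d chi) :
  is_ps_fermionic_integral p abs q d
    (fun x n => ps_exp x%:R n * chi x%:Z)
    (frobenius_euler_series d chi q) /\
  (forall n, frobenius_euler_series d chi q n =
             frobenius_euler d chi q n / n`!%:R).
Proof.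
have absP := Cp_abs CpP; have [chi_mod_d _] := chiP.
split=> n; first exact: fermionic_integral_periodic (dchar_per chi_mod_d) n.
by rewrite /frobenius_euler mulrC mulKf ?(padic_natr_neq0 p_prime absP) ?fact_gt0.
Qed.
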